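(* Let $L \subseteq {}^*\mathbb{R}^n$ be an internal lattice. Then for each finite vector $x \in {}^*\!\operatorname{span}(L)$ such that $|u\,x|_{\mathbb{Z}} \approx 0$ for every finite $u \in L$, there is a $y \in L'$ such that $y \approx x$.
   Context: Let $I = \{1,2,3,\dots\}$ and fix a nonprincipal ultrafilter $D$ on $I$. Put ${}^*\mathbb{R} = \mathbb{R}^I/D$ (hyperreals) and ${}^*\mathbb{Z} = \mathbb{Z}^I/D \subseteq {}^*\mathbb{R}$ (hyperintegers). A hyperreal $x$ is finite (written $|x| < \infty$) if $|x| < r$ for some positive real $r$, and infinitesimal (written $x \approx 0$) if $|x| < r$ for all positive real $r$. For fixed $n \ge 1$, ${}^*\mathbb{R}^n = ({}^*\mathbb{R})^n$ is identified with $(\mathbb{R}^n)^I/D$; the inner product $u\,x = u_1x_1+\ldots+u_nx_n$ and the euclidean norm $\|x\| = \sqrt{x\,x}$ extend to ${}^*\mathbb{R}^n$ with values in ${}^*\mathbb{R}$. A vector $x \in {}^*\mathbb{R}^n$ is finite if $\|x\| < \infty$; $x \approx y$ means $\|x-y\| \approx 0$. For $a \in {}^*\mathbb{R}$, $|a|_{\mathbb{Z}}$ denotes the (internal) distance $\min_{c \in {}^*\mathbb{Z}} |a-c|$ from the hyperintegers. A lattice in $\mathbb{R}^n$ is a discrete additive subgroup of $\mathbb{R}^n$. An internal lattice in ${}^*\mathbb{R}^n$ is an ultraproduct $L = \prod_{i\in I} L_i/D$ of lattices $L_i \subseteq \mathbb{R}^n$, viewed as a subset of ${}^*\mathbb{R}^n$.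 ${}^*\!\operatorname{span}(L)$ is the ${}^*\mathbb{R}$-linear subspace of ${}^*\mathbb{R}^n$ generated by $L$. The internal dual lattice is $L' = \{x \in {}^*\!\operatorname{span}(L) : u\,x \in {}^*\mathbb{Z} \text{ for all } u \in L\}$, equivalently $\prod L_i'/D$, where $L_i' = \{x \in \operatorname{span}(L_i) : u\,x \in \mathbb{Z} \text{ for all } u \in L_i\}$. *)

(* Defs.v *)
From HB Require Import structures.
From mathcomp Require Import all_boot all_order all_algebra generic_quotient.
From mathcomp Require Import all_classical all_reals.
From mathcomp Require Import topology normedtype.
From mathcomp Require Import lra.

Set Implicit Arguments.
Unset Strict Implicit.
Unset Printing Implicit Defensive.

Import Order.TTheory GRing.Theory Num.Theory.
Import numFieldNormedType.Exports.

Local Open Scope classical_set_scope.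
Local Open Scope quotient_scope.
Local Open Scope ring_scope.

Definition posnat := {i : nat | (0 < i)%N}.

(* With [UltraFilter D] this excludes exactly the ultrafilters of the form
   [principal_filter i]. *)
Definition nonprincipal (I : Type) (D : set_system I) :=
  forall i : I, D <> principal_filter i.

Section Hyperreal.
Variables (R : realType) (D : set_system posnat) (UD : UltraFilter D).
Implicit Types f g : posnat -> R.

Definition eq_ae f g : bool := `[< D [set i | f i = g i] >].

Lemma eq_ae_refl : reflexive eq_ae.
Proof. by move=> f; apply/asboolP; apply: filterS filterT => i. Qed.

Lemma eq_ae_sym : symmetric eq_ae.
Proof.
by move=> f g; apply/asboolP/asboolP => H; apply: filterS H => i /= ->.
Qed.

Lemma eq_ae_trans : transitive eq_ae.
Proof.
move=> g f h /asboolP H1 /asboolP H2; apply/asboolP.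
by apply: filterS2 H1 H2 => i /= -> ->.
Qed.

Canonical eq_ae_equiv := EquivRel eq_ae eq_ae_refl eq_ae_sym eq_ae_trans.

Definition hyperreal := {eq_quot eq_ae_equiv}.

HB.instance Definition _ := Choice.on hyperreal.
HB.instance Definition _ := EqQuotient.on hyperreal.

Definition hyp f : hyperreal := \pi_hyperreal f.

Definition std (r : R) : hyperreal := hyp (fun=> r).

Lemma hypE f g : (hyp f = hyp g) <-> D [set i | f i = g i].
Proof.
split=> [/eqP|H]; first by rewrite /hyp eqmodE => /asboolP.
by apply/eqP; rewrite /hyp eqmodE; apply/asboolP.
Qed.

Lemma hyp_repr (x : hyperreal) : hyp (repr x) = x.
Proof. exact: reprK. Qed.

Lemma repr_hyp f : D [set i | repr (hyp f) i = f i].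
Proof. by apply/hypE; rewrite hyp_repr. Qed.

Definition hyp_opp (x : hyperreal) := hyp (fun i => - repr x i).
Definition hyp_add (x y : hyperreal) := hyp (fun i => repr x i + repr y i).
Definition hyp_mul (x y : hyperreal) := hyp (fun i => repr x i * repr y i).
Definition hyp_inv (x : hyperreal) := hyp (fun i => (repr x i)^-1).
Definition hyp_norm (x : hyperreal) := hyp (fun i => `|repr x i|).
Definition hyp_le (x y : hyperreal) : bool :=
  `[< D [set i | repr x i <= repr y i] >].
Definition hyp_lt (x y : hyperreal) : bool :=
  `[< D [set i | repr x i < repr y i] >].

Lemma hyp_oppE f : hyp_opp (hyp f) = hyp (fun i => - f i).
Proof. by apply/hypE; apply: filterS (repr_hyp f) => i /= ->. Qed.

Lemma hyp_addE f g : hyp_add (hyp f) (hyp g) = hyp (fun i => f i + g i).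
Proof.
by apply/hypE; apply: filterS2 (repr_hyp f) (repr_hyp g) => i /= -> ->.
Qed.

Lemma hyp_mulE f g : hyp_mul (hyp f) (hyp g) = hyp (fun i => f i * g i).
Proof.
by apply/hypE; apply: filterS2 (repr_hyp f) (repr_hyp g) => i /= -> ->.
Qed.

Lemma hyp_invE f : hyp_inv (hyp f) = hyp (fun i => (f i)^-1).
Proof. by apply/hypE; apply: filterS (repr_hyp f) => i /= ->. Qed.

Lemma hyp_normE f : hyp_norm (hyp f) = hyp (fun i => `|f i|).
Proof. by apply/hypE; apply: filterS (repr_hyp f) => i /= ->. Qed.

Lemma hyp_leP f g : reflect (D [set i | f i <= g i]) (hyp_le (hyp f) (hyp g)).
Proof.
have [Hf Hg] := (repr_hyp f, repr_hyp g).
by apply: (iffP (asboolP _)) => H;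
   apply: filterS3 Hf Hg H => i /= -> ->.
Qed.

Lemma hyp_ltP f g : reflect (D [set i | f i < g i]) (hyp_lt (hyp f) (hyp g)).
Proof.
have [Hf Hg] := (repr_hyp f, repr_hyp g).
by apply: (iffP (asboolP _)) => H;
   apply: filterS3 Hf Hg H => i /= -> ->.
Qed.

Lemma hypP (x : hyperreal) : exists f, x = hyp f.
Proof. by exists (repr x); rewrite hyp_repr. Qed.

Lemma hyp_ext f g : f =1 g -> hyp f = hyp g.
Proof. by move=> fg; congr hyp; apply/funext. Qed.

Let addA : associative hyp_add.
Proof.
move=> x y z; case: (hypP x) (hypP y) (hypP z) => f -> [g ->] [h ->].
by rewrite !hyp_addE; apply: hyp_ext => i; rewrite addrA.
Qed.

Let addC : commutative hyp_add.
Proof. by move=> x y; apply: hyp_ext => i; rewrite addrC. Qed.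

Let add0 : left_id (std 0) hyp_add.
Proof.
move=> x; case: (hypP x) => f ->.
by rewrite hyp_addE; apply: hyp_ext => i; rewrite add0r.
Qed.

Let addN : left_inverse (std 0) hyp_opp hyp_add.
Proof.
move=> x; case: (hypP x) => f ->.
by rewrite hyp_oppE hyp_addE; apply: hyp_ext => i; rewrite addNr.
Qed.

HB.instance Definition _ :=
  GRing.isZmodule.Build hyperreal addA addC add0 addN.

Let mulA : associative hyp_mul.
Proof.
move=> x y z; case: (hypP x) (hypP y) (hypP z) => f -> [g ->] [h ->].
by rewrite !hyp_mulE; apply: hyp_ext => i; rewrite mulrA.
Qed.

Let mulC : commutative hyp_mul.
Proof. by move=> x y; apply: hyp_ext => i; rewrite mulrC. Qed.

Let mul1 : left_id (std 1) hyp_mul.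
Proof.
move=> x; case: (hypP x) => f ->.
by rewrite hyp_mulE; apply: hyp_ext => i; rewrite mul1r.
Qed.

Let mulD : left_distributive hyp_mul +%R.
Proof.
move=> x y z; case: (hypP x) (hypP y) (hypP z) => f -> [g ->] [h ->].
rewrite [_ + _]hyp_addE !hyp_mulE [RHS]hyp_addE.
by apply: hyp_ext => i; rewrite mulrDl.
Qed.

Let one_neq0 : std 1 != 0.
Proof.
apply/eqP => /hypE /filter_ex [i /= /eqP].
by rewrite oner_eq0.
Qed.

HB.instance Definition _ :=
  GRing.Zmodule_isComNzRing.Build hyperreal mulA mulC mul1 mulD one_neq0.

Let mulV (x : hyperreal) : x != 0 -> hyp_inv x * x = 1.
Proof.
case: (hypP x) => f -> /eqP f0; rewrite hyp_invE [LHS]hyp_mulE.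
apply/hypE; have [|f0'] := in_ultra_setVsetC [set i | f i = 0] UD.
  by move=> /(hypE f (fun=> 0)).
by apply: filterS f0' => i /= /eqP fi0; rewrite mulVf.
Qed.

Let inv0 : hyp_inv 0 = 0.
Proof. by rewrite hyp_invE; apply: hyp_ext => i; rewrite invr0. Qed.

HB.instance Definition _ := GRing.ComNzRing_isField.Build hyperreal mulV inv0.

Let le0_add (x y : hyperreal) : hyp_le 0 x -> hyp_le 0 y -> hyp_le 0 (x + y).
Proof.
case: (hypP x) (hypP y) => f -> [g ->] /hyp_leP f0 /hyp_leP g0.
rewrite [_ + _]hyp_addE; apply/hyp_leP.
by apply: filterS2 f0 g0 => i /=; apply: addr_ge0.
Qed.

Let le0_mul (x y : hyperreal) : hyp_le 0 x -> hyp_le 0 y -> hyp_le 0 (x * y).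
Proof.
case: (hypP x) (hypP y) => f -> [g ->] /hyp_leP f0 /hyp_leP g0.
rewrite [_ * _]hyp_mulE; apply/hyp_leP.
by apply: filterS2 f0 g0 => i /=; apply: mulr_ge0.
Qed.

Let le0_anti (x : hyperreal) : hyp_le 0 x -> hyp_le x 0 -> x = 0.
Proof.
case: (hypP x) => f -> /hyp_leP f0 /hyp_leP f0'; apply/hypE.
by apply: filterS2 f0 f0' => i /= ? ?; apply/eqP; rewrite eq_le; apply/andP.
Qed.

Let sub_ge0 (x y : hyperreal) : hyp_le 0 (y - x) = hyp_le x y.
Proof.
case: (hypP x) (hypP y) => f -> [g ->].
rewrite [- _]hyp_oppE [_ + _]hyp_addE.
by apply/hyp_leP/hyp_leP => H; apply: filterS H => i /=; rewrite subr_ge0.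
Qed.

Let le0_total (x : hyperreal) : hyp_le 0 x || hyp_le x 0.
Proof.
case: (hypP x) => f ->.
have [H|H] := in_ultra_setVsetC [set i | 0 <= f i] UD; apply/orP.
  by left; apply/hyp_leP.
by right; apply/hyp_leP; apply: filterS H => i /= /negP; rewrite -ltNge => /ltW.
Qed.

Let normN (x : hyperreal) : hyp_norm (- x) = hyp_norm x.
Proof.
case: (hypP x) => f ->; rewrite [- _]hyp_oppE !hyp_normE.
by apply: hyp_ext => i; rewrite normrN.
Qed.

Let ge0_norm (x : hyperreal) : hyp_le 0 x -> hyp_norm x = x.
Proof.
case: (hypP x) => f -> /hyp_leP f0; rewrite hyp_normE; apply/hypE.
by apply: filterS f0 => i /= /ger0_norm.
Qed.

Let lt_def (x y : hyperreal) : hyp_lt x y = (y != x) && hyp_le x y.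
Proof.
case: (hypP x) (hypP y) => f -> [g ->].
apply/hyp_ltP/andP => [H|[/eqP gf /hyp_leP H]].
  split; last by apply/hyp_leP; apply: filterS H => i /= /ltW.
  apply/eqP => /hypE E; have HE : D ([set i | f i < g i] `&` [set i | g i = f i]) by exact: filterI.
  by have [i [/= /[swap] ->]] := filter_ex HE; rewrite ltxx.
have [E|E] := in_ultra_setVsetC [set i | g i = f i] UD.
  by exfalso; apply: gf; apply/hypE.
by apply: filterS2 H E => i /= fg /eqP gfi; rewrite lt_def gfi.
Qed.

HB.instance Definition _ := Num.IntegralDomain_isLeReal.Build hyperreal
  le0_add le0_mul le0_anti sub_ge0 le0_total normN ge0_norm lt_def.

Lemma hypN f : - hyp f = hyp (fun i => - f i).
Proof. exact: hyp_oppE. Qed.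

Lemma hypD f g : hyp f + hyp g = hyp (fun i => f i + g i).
Proof. exact: hyp_addE. Qed.

Lemma hypB f g : hyp f - hyp g = hyp (fun i => f i - g i).
Proof. by rewrite hypN hypD. Qed.

Lemma hypM f g : hyp f * hyp g = hyp (fun i => f i * g i).
Proof. exact: hyp_mulE. Qed.

Lemma hyp_abs f : `|hyp f| = hyp (fun i => `|f i|).
Proof. exact: hyp_normE. Qed.

Lemma ler_hyp f g : (hyp f <= hyp g) <-> D [set i | f i <= g i].
Proof. by split => [/hyp_leP|/hyp_leP]. Qed.

Lemma ltr_hyp f g : (hyp f < hyp g) <-> D [set i | f i < g i].
Proof. by split => [/hyp_ltP|/hyp_ltP]. Qed.

Lemma hypX f n : hyp f ^+ n = hyp (fun i => f i ^+ n).
Proof.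
elim: n => [|n IHn]; first by rewrite expr0.
by rewrite exprS IHn hypM; apply: hyp_ext => i; rewrite exprS.
Qed.

Lemma hyp_sum (J : Type) (s : seq J) (F : J -> posnat -> R) :
  \sum_(j <- s) hyp (F j) = hyp (fun i => \sum_(j <- s) F j i).
Proof.
elim: s => [|j s IHs].
  by rewrite big_nil; apply: hyp_ext => i; rewrite big_nil.
by rewrite big_cons IHs hypD; apply: hyp_ext => i; rewrite big_cons.
Qed.

Lemma horner_hyp (p : {poly hyperreal}) f :
  p.[hyp f] = hyp (fun i => (\poly_(j < size p) repr (p`_j) i).[f i]).
Proof.
rewrite horner_coef.
transitivity (\sum_(j < size p) hyp (fun i => repr p`_j i * f i ^+ j)).
  by apply: eq_bigr => j _; rewrite hypX -{1}[p`_j]hyp_repr hypM.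
by rewrite hyp_sum; apply: hyp_ext => i; rewrite horner_poly.
Qed.

Let real_closed : Num.real_closed_axiom hyperreal.
Proof.
move=> p a b; case: (hypP a) (hypP b) => f -> [g ->].
rewrite !horner_hyp; pose P i := \poly_(j < size p) repr p`_j i.
move=> /ler_hyp fg /andP[/ler_hyp pf /ler_hyp pg].
pose S i := [set x : R | f i <= x <= g i /\ root (P i) x].
have PS : D [set i | S i (xget 0 (S i))].
  apply: filterS3 fg pf pg => i /= fgi pfi pgi.
  have [||x fxg px] := @poly_ivt R (P i) (f i) (g i) => //.
    by rewrite pfi pgi.
  by apply: (@xgetPex _ 0 (S i)); exists x.
exists (hyp (fun i => xget 0 (S i))).
  by apply/andP; split; apply/ler_hyp; apply: filterS PS => i /= [/andP[]].
rewrite /root horner_hyp; apply/eqP/hypE.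
by apply: filterS PS => i /= [_ /rootP].
Qed.

HB.instance Definition _ := Num.RealField_isClosed.Build hyperreal real_closed.

End Hyperreal.

Section Euclidean.
Variable K : rcfType.

Definition dot (n : nat) (u x : 'rV[K]_n) : K := \sum_(j < n) u 0 j * x 0 j.

Definition enorm (n : nat) (x : 'rV[K]_n) : K := Num.sqrt (dot x x).

End Euclidean.

Definition is_lattice (R : realType) (n : nat) (L : set 'rV[R]_n) : Prop :=
  zmod_closed (mem L) /\ L `<=` isolated L.

Definition linear_span (K : fieldType) (n : nat) (A : set 'rV[K]_n) :
    set 'rV[K]_n :=
  smallest (fun V : set 'rV[K]_n => submod_closed (mem V)) A.

Section Nonstandard.
Variables (R : realType) (D : set_system posnat) (UD : UltraFilter D).
Local Notation HR := (hyperreal R UD).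

Definition finite_hyp (x : HR) : Prop := exists2 r : R, 0 < r & `|x| < std UD r.

Definition infinitesimal (x : HR) : Prop :=
  forall r : R, 0 < r -> `|x| < std UD r.

Definition hyperint : set HR :=
  [set x | exists c : posnat -> int, x = hyp UD (fun i => (c i)%:~R)].

(* The infimum in the ordered field of hyperreals, which is not order complete;
   [dist_hyperint_min] shows that it is attained, i.e. it is a minimum. *)
Definition dist_hyperint (a : HR) : HR :=
  infimum 0 [set `|a - c| | c in hyperint].

Lemma dist_hyperint_min (a : HR) :
  (exists2 c, hyperint c & dist_hyperint a = `|a - c|) /\
  (forall c, hyperint c -> dist_hyperint a <= `|a - c|).
Proof.
have [f ->] := hypP a.
pose k i := Num.floor (f i + 2^-1).
have kP i (m : int) : `|f i - (k i)%:~R| <= `|f i - m%:~R|.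
  have /andP[] := floor_itv (f i + 2^-1).
  rewrite -/(k i) intrD => k1 k2.
  have [->//|mk] := eqVneq m (k i).
  have : 1 <= `|m%:~R - (k i)%:~R : R|.
    by rewrite -intrB -intr_norm ler1z -gtz0_ge1 normr_gt0 subr_eq0.
  have := ler_distD (f i) (m%:~R) (k i)%:~R.
  rewrite (distrC m%:~R (f i)).
  have : `|f i - (k i)%:~R| <= 2^-1 by rewrite ler_norml; lra.
  lra.
pose z : HR := hyp UD (fun i => (k i)%:~R).
have z_int : hyperint z by exists k.
have z_min c : hyperint c -> `|hyp UD f - z| <= `|hyp UD f - c|.
  move=> [m ->]; rewrite !hypB !hyp_abs; apply/ler_hyp.
  by apply: filterS filterT => i _; exact: kP.
suff -> : dist_hyperint (hyp UD f) = `|hyp UD f - z| by split => //; exists z.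
set A := [set `|hyp UD f - c| | c in hyperint].
have Az : A `|hyp UD f - z| by exists z.
have zA : infimums A `|hyp UD f - z|.
  split; first by move=> _ [c c_int <-]; exact: z_min.
  by move=> y; exact.
rewrite /dist_hyperint /infimum -/A; case: eqP => [A0|_].
  by move: Az; rewrite A0.
apply: (@is_subset1_infimums _ _ A) => //.
exact: (xgetPex 0 (ex_intro _ _ zA)).
Qed.

Section Vectors.
Variable n : nat.

Definition finite_vec (x : 'rV[HR]_n) : Prop := finite_hyp (enorm x).

Definition approx (x y : 'rV[HR]_n) : Prop := infinitesimal (enorm (x - y)).

(* The identification of (R^n)^I / D with (R^I / D)^n. *)
Definition hypvec (f : posnat -> 'rV[R]_n) : 'rV[HR]_n :=
  \row_j hyp UD (fun i => f i 0 j).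

Definition ultraproduct (A : posnat -> set 'rV[R]_n) : set 'rV[HR]_n :=
  [set hypvec f | f in [set f | forall i, A i (f i)]].

Definition internal_lattice (L : set 'rV[HR]_n) : Prop :=
  exists2 Li : posnat -> set 'rV[R]_n,
    forall i, is_lattice (Li i) & L = ultraproduct Li.

Definition dual_lattice (L : set 'rV[HR]_n) : set 'rV[HR]_n :=
  [set x | linear_span L x /\ forall u, L u -> hyperint (dot u x)].

Lemma hypvecP (x : 'rV[HR]_n) : exists f, x = hypvec f.
Proof.
exists (fun i => \row_j repr (x 0 j) i); apply/rowP => j.
by rewrite mxE -[LHS]hyp_repr; apply: hyp_ext => i; rewrite mxE.
Qed.

Lemma hypvecE (f g : posnat -> 'rV[R]_n) :
  hypvec f = hypvec g <-> D [set i | f i = g i].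
Proof.
split=> [fg|fg]; last first.
  by apply/rowP => j; rewrite !mxE; apply/hypE; apply: filterS fg => i /= ->.
have : D [set i | forall j : 'I_n, f i 0 j = g i 0 j].
  apply: filter_forall => j; apply/(hypE UD).
  by have /rowP/(_ j) := fg; rewrite !mxE.
by apply: filterS => i /= H; apply/rowP.
Qed.

Lemma dot_hypvec (f g : posnat -> 'rV[R]_n) :
  dot (hypvec f) (hypvec g) = hyp UD (fun i => dot (f i) (g i)).
Proof. by rewrite -hyp_sum; apply: eq_bigr => j _; rewrite !mxE hypM. Qed.

Lemma enorm_hypvec (f : posnat -> 'rV[R]_n) :
  enorm (hypvec f) = hyp UD (fun i => enorm (f i)).
Proof.
have dot_ge0 i : 0 <= dot (f i) (f i).
  by apply: sumr_ge0 => j _; rewrite -expr2 sqr_ge0.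
have -> : hyp UD (fun i => enorm (f i)) = `|hyp UD (fun i => enorm (f i))|.
  by rewrite hyp_abs; apply: hyp_ext => i; rewrite ger0_norm ?sqrtr_ge0.
rewrite -sqrtr_sqr hypX /enorm dot_hypvec; congr Num.sqrt.
by apply: hyp_ext => i; rewrite sqr_sqrtr.
Qed.

End Vectors.
End Nonstandard.

(* Main.v *)
Require Import Defs.
From mathcomp Require Import all_boot all_order all_algebra.
From mathcomp Require Import all_classical all_reals.
From mathcomp Require Import topology normedtype.
From mathcomp Require Import ring lra.

Set Implicit Arguments.
Unset Strict Implicit.
Unset Printing Implicit Defensive.

Import Order.TTheory GRing.Theory Num.Theory.
Import numFieldNormedType.Exports.

Local Open Scope classical_set_scope.
Local Open Scope ring_scope.

(** The theorem is the nonstandard form of a uniform statement about lattices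
in R^n: for every e > 0 there are d > 0 and r > 0, depending only on n and e,
such that if u x is within d of an integer for all lattice vectors u of length
at most r, then some z of length at most e in the span of the lattice makes
u (x + z) an integer for all lattice vectors u ([exact_from_approximate]).

The uniform statement is proved by induction on the rank.  Take a nearly
shortest nonzero vector b, and let a be the difference of b x and its
nearest integer.  If |a| were large compared with |b| / r, some multiple j b of
length at most r would have j |a| between 1/4 and 1/2, hence an inner product
with x far from the integers ([small_remainder]).  So the multiple z1 of b with
b z1 = -a is short, and adding it to x makes the inner product with b an
integer.  What remains is a condition modulo Z on the projection of the lattice
to the orthogonal complement of b.  Since b is nearly shortest, this projection
is again discrete and its short vectors lift to short lattice vectors
([discrete_projection], [short_lift]), so the induction hypothesis provides a
correction z2 orthogonal to b.

To make the induction close up, the form u |-> u x is replaced by any function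
h on the lattice that is additive modulo Z: on the projected lattice the values
of h are only defined modulo Z, and no vector x representing them has to be
found.  The correction is moreover produced as a combination of boundedly many
lattice vectors, so that its class in the ultraproduct lies in the external
linear span of the internal lattice.

For the transfer, let the internal lattice be given by lattices L_i and x by
vectors x_i.  If the uniform statement could not be applied at almost every i,
the lattice vectors witnessing this would form a finite internal vector u with
u x at noninfinitesimal distance from the hyperintegers
([internal_exact_from_approximate]).  So corrections of length at most 1/(k+1)
exist for every standard k, and countable saturation, which holds because the
ultrafilter is nonprincipal, gives a single infinitesimal correction. *)

(** * The dot product *)

Section DotProduct.
Variables (K : rcfType) (n : nat).
Implicit Types (a : K) (u v w b : 'rV[K]_n).

Lemma dotC u v : dot u v = dot v u.
Proof. by apply: eq_bigr => j _; rewrite mulrC. Qed.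

Lemma dotDl u v w : dot (u + v) w = dot u w + dot v w.
Proof. by rewrite -big_split; apply: eq_bigr => j _; rewrite !mxE mulrDl. Qed.

Lemma dotZl a u v : dot (a *: u) v = a * dot u v.
Proof. by rewrite mulr_sumr; apply: eq_bigr => j _; rewrite !mxE mulrA. Qed.

Lemma dotNl u v : dot (- u) v = - dot u v.
Proof. by rewrite -scaleN1r dotZl mulN1r. Qed.

Lemma dotBl u v w : dot (u - v) w = dot u w - dot v w.
Proof. by rewrite dotDl dotNl. Qed.

Lemma dot0l v : dot 0 v = 0.
Proof. by rewrite -(scale0r 0) dotZl mul0r. Qed.

Lemma dotDr u v w : dot u (v + w) = dot u v + dot u w.
Proof. by rewrite dotC dotDl !(dotC u). Qed.

Lemma dotZr a u v : dot u (a *: v) = a * dot u v.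
Proof. by rewrite dotC dotZl dotC. Qed.

Lemma dotBr u v w : dot u (v - w) = dot u v - dot u w.
Proof. by rewrite dotC dotBl !(dotC u). Qed.

Lemma dot_sumr (m : nat) u (F : 'I_m -> 'rV[K]_n) :
  dot u (\sum_(j < m) F j) = \sum_(j < m) dot u (F j).
Proof.
elim/big_rec2: _ => [|j y1 y2 _ <-]; first by rewrite dotC dot0l.
by rewrite dotDr.
Qed.

Lemma dot_ge0 u : 0 <= dot u u.
Proof. by apply: sumr_ge0 => j _; rewrite -expr2 sqr_ge0. Qed.

Lemma coord_sqr_le u (j : 'I_n) : u 0 j ^+ 2 <= dot u u.
Proof.
rewrite /dot (bigD1 j) //= expr2 lerDl.
by apply: sumr_ge0 => k _; rewrite -expr2 sqr_ge0.
Qed.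

Lemma dot_gt0 u : u != 0 -> 0 < dot u u.
Proof.
move=> u0; rewrite lt_def dot_ge0 andbT; apply: contra u0 => /eqP u0.
apply/eqP/rowP => j; rewrite mxE; apply/eqP.
by rewrite -(sqrf_eq0 (u 0 j)) eq_le sqr_ge0 -u0 coord_sqr_le.
Qed.

Definition perp_part b u := u - (dot u b / dot b b) *: b.

Lemma perp_partB b u v : perp_part b (u - v) = perp_part b u - perp_part b v.
Proof.
by rewrite /perp_part dotBl mulrBl scalerBl !opprD !opprK addrACA.
Qed.

Lemma perp_partZ b a u : perp_part b (a *: u) = a *: perp_part b u.
Proof. by rewrite /perp_part dotZl scalerBr scalerA mulrA. Qed.

Lemma perp_part0 b : perp_part b 0 = 0.
Proof. by rewrite /perp_part dot0l mul0r scale0r subr0. Qed.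

Lemma perp_part_self b : b != 0 -> perp_part b b = 0.
Proof.
by move=> b0; rewrite /perp_part divff ?scale1r ?subrr // gt_eqF ?dot_gt0.
Qed.

Lemma dot_perp_part b u : b != 0 -> dot (perp_part b u) b = 0.
Proof.
by move=> b0; rewrite dotBl dotZl divfK ?subrr // gt_eqF ?dot_gt0.
Qed.

Lemma dot_perp_partl b u z : dot z b = 0 -> dot (perp_part b u) z = dot u z.
Proof. by move=> zb; rewrite dotBl dotZl (dotC b) zb mulr0 subr0. Qed.

Lemma pythagoras b u : b != 0 ->
  dot u u = dot (perp_part b u) (perp_part b u)
            + (dot u b / dot b b) ^+ 2 * dot b b.
Proof.
move=> b0; rewrite [in X in dot _ X + _]/perp_part dotBr dotZr.
rewrite dot_perp_part // mulr0 subr0.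
have tb : dot u b / dot b b * dot b b = dot u b.
  by rewrite divfK ?gt_eqF ?dot_gt0.
rewrite /perp_part dotBl dotZl (dotC b) expr2.
by rewrite -(mulrA _ _ (dot b b)) tb subrK.
Qed.

End DotProduct.

(** * Distance to the integers *)

Section Rounding.
Variable R : realType.

(** A number of absolute value at most 1/2 has 0 as a nearest integer. *)
Lemma near_int0 (d e c : R) : `|d| <= 2^-1 -> c \is a Num.int ->
  `|d - c| <= e -> `|d| <= e.
Proof.
move=> d2 /intrP[k ->]; have [->|k0] := eqVneq k 0; first by rewrite subr0.
have : 1 <= `|k%:~R : R| by rewrite -intr_norm ler1z -gtz0_ge1 normr_gt0.
have := lerB_dist k%:~R d; rewrite distrC.
lra.
Qed.

Lemma nearest_int (a : R) : exists2 c, c \is a Num.int & `|a - c| <= 2^-1.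
Proof.
exists (Num.floor (a + 2^-1))%:~R; first exact: intr_int.
have /andP[] := floor_itv (a + 2^-1); rewrite intrD ler_norml => k1 k2.
by apply/andP; split; lra.
Qed.

(** The largest multiple of d not exceeding 1/2 works, because adding d, which
is no larger than that multiple, already exceeds 1/2. *)
Lemma multiple_in_quarter_half (d : R) : 0 < d -> d <= 2^-1 ->
  exists j : nat, 4^-1 < j%:R * d <= 2^-1.
Proof.
move=> d0 d2; pose j := Num.truncn (2^-1 / d).
have /truncn_itv : 0 <= 2^-1 / d by rewrite divr_ge0 ?invr_ge0 // ltW.
rewrite -/j => /andP[j1 j2].
exists j; have jd : j%:R * d <= 2^-1 by rewrite -ler_pdivlMr.
rewrite jd andbT.
have jd' : 2^-1 < (j%:R + 1) * d by rewrite -ltr_pdivrMr // natr1.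
have [j0|j_gt0] := posnP j.
  by move: jd'; rewrite j0; lra.
have : 1 * d <= j%:R * d by rewrite ler_pM2r // ler1n.
lra.
Qed.

(** * Discrete subgroups and functions additive modulo the integers *)

Variable n : nat.
Implicit Types (L : set 'rV[R]_n) (h : 'rV[R]_n -> R) (u v w b : 'rV[R]_n).

(** Discreteness is expressed by a lower bound on the squared length of nonzero
vectors; this is the form that passes to projections and yields nearly shortest
vectors without a compactness argument. *)
Definition discrete_subgroup L :=
  [/\ L 0, forall u v, L u -> L v -> L (u - v)
    & exists2 l, 0 < l & forall u, L u -> u != 0 -> l <= dot u u].

Lemma lattice_discrete_subgroup L : is_lattice L -> discrete_subgroup L.
Proof.
case=> -[L0 LB] iL; split.
- exact/set_mem.
- by move=> u v /mem_set Lu /mem_set Lv; apply/set_mem/LB.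
have [_ [V V0 VL]] := iL _ (set_mem L0).
move: V0 => /nbhs_ballP[e /= e0 eV].
exists (e ^+ 2); first by rewrite exprn_gt0.
move=> u Lu u0; rewrite leNgt; apply: contra u0 => ule.
suff : (V `&` L) u by rewrite VL => ->.
split=> //; apply: eV; rewrite /ball /= /mx_ball; split=> // i j.
rewrite mxE ord1 /ball /= sub0r normrN.
rewrite -(ltr_pXn2r (n := 2)) ?nnegrE // ?ltW //.
by rewrite real_normK ?num_real // (le_lt_trans (coord_sqr_le _ _)).
Qed.

Definition additive_modZ L h :=
  forall u v, L u -> L v -> h (u - v) - (h u - h v) \is a Num.int.

Section Additive.
Variables (L : set 'rV[R]_n) (h : 'rV[R]_n -> R).
Hypotheses (dL : discrete_subgroup L) (hL : additive_modZ L h).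

Lemma subgroup0 : L 0. Proof. by case: dL. Qed.

Lemma subgroupB u v : L u -> L v -> L (u - v).
Proof. by case: dL => _ + _; exact. Qed.

Lemma subgroupN u : L u -> L (- u).
Proof. by rewrite -sub0r; apply: subgroupB; exact: subgroup0. Qed.

Lemma subgroupD u v : L u -> L v -> L (u + v).
Proof. by move=> Lu /subgroupN Lv; rewrite -[v]opprK; exact: subgroupB. Qed.

Lemma subgroupMn u k : L u -> L (k%:R *: u).
Proof.
move=> Lu; elim: k => [|k IHk]; first by rewrite scale0r; exact: subgroup0.
by rewrite -natr1 scalerDl scale1r; exact: subgroupD.
Qed.

Lemma subgroupMz u (c : R) : c \is a Num.int -> L u -> L (c *: u).
Proof.
move=> + Lu => /intrP[[k|k] ->]; first exact: subgroupMn.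
by rewrite NegzE mulrNz scaleNr; apply: subgroupN; exact: subgroupMn.
Qed.

Lemma modZ0 : h 0 \is a Num.int.
Proof.
have := hL subgroup0 subgroup0; rewrite subrr subrr subr0; exact.
Qed.

Lemma modZN u : L u -> h (- u) + h u \is a Num.int.
Proof.
move=> Lu; have := hL subgroup0 Lu; rewrite sub0r => H.
by have := rpredD H modZ0; congr (is_true (_ \is a Num.int)); ring.
Qed.

Lemma modZD u v : L u -> L v -> h (u + v) - (h u + h v) \is a Num.int.
Proof.
move=> Lu Lv; have := hL Lu (subgroupN Lv); rewrite opprK => H.
by have := rpredB H (modZN Lv); congr (is_true (_ \is a Num.int)); ring.
Qed.

Lemma modZMn u k : L u -> h (k%:R *: u) - k%:R * h u \is a Num.int.
Proof.
move=> Lu; elim: k => [|k IHk]; first by rewrite scale0r mul0r subr0 modZ0.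
rewrite -natr1 scalerDl scale1r.
have := rpredD (modZD (subgroupMn k Lu) Lu) IHk.
by congr (is_true (_ \is a Num.int)); ring.
Qed.

Lemma modZMz u (c : R) : c \is a Num.int -> L u ->
  h (c *: u) - c * h u \is a Num.int.
Proof.
move=> + Lu => /intrP[[k|k] ->]; first exact: modZMn.
rewrite NegzE mulrNz scaleNr.
have := rpredB (modZN (subgroupMn k.+1 Lu)) (modZMn k.+1 Lu).
by congr (is_true (_ \is a Num.int)); ring.
Qed.

End Additive.

(** The factor 2 leaves room both for replacing a minimum by an infimum and for
the 1/4 lost in size reduction. *)
Lemma exists_near_shortest L : discrete_subgroup L ->
  (exists2 u, L u & u != 0) ->
  exists b, [/\ L b, b != 0 &
    forall u, L u -> u != 0 -> dot b b <= 2 * dot u u].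
Proof.
case=> _ _ [l l0 lL] [u0 Lu0 nz_u0].
pose S := [set dot u u | u in [set u | L u /\ u != 0]].
have hS : has_inf S.
  split; first by exists (dot u0 u0), u0.
  by exists l => _ [u [Lu nz_u] <-]; exact: lL.
have S0 : 0 < inf S.
  apply: (lt_le_trans l0); apply: lb_le_inf; first by case: hS.
  by move=> _ [u [Lu nz_u] <-]; exact: lL.
have [_ [b [Lb nz_b] <-] bS] := inf_adherent S0 hS.
exists b; split=> // u Lu nz_u.
have : inf S <= dot u u by apply: ge_inf; [case: hS | exists u].
lra.
Qed.

(** * Projection along a nearly shortest vector *)

Section Projection.
Variables (L : set 'rV[R]_n) (b : 'rV[R]_n).
Hypotheses (dL : discrete_subgroup L) (Lb : L b) (nz_b : b != 0).
Hypothesis b_short : forall u, L u -> u != 0 -> dot b b <= 2 * dot u u.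

Let bb_gt0 : 0 < dot b b. Proof. exact: dot_gt0. Qed.

(** Subtracting the integer multiple of b nearest to the component of u along b
leaves a component of length at most |b| / 2; Pythagoras gives the bound. *)
Lemma size_reduction u : L u ->
  exists c, [/\ c \is a Num.int, L (u - c *: b),
    perp_part b (u - c *: b) = perp_part b u &
    4 * dot (u - c *: b) (u - c *: b)
      <= 4 * dot (perp_part b u) (perp_part b u) + dot b b].
Proof.
move=> Lu; have [c cZ cP] := nearest_int (dot u b / dot b b).
have pE : perp_part b (u - c *: b) = perp_part b u.
  by rewrite perp_partB perp_partZ perp_part_self // scaler0 subr0.
exists c; split=> //; first by apply: subgroupB => //; exact: subgroupMz.
rewrite (pythagoras _ nz_b) pE mulrDr lerD2l dotBl dotZl mulrBl.
rewrite (mulfK (lt0r_neq0 bb_gt0)) mulrA ger_pMl //.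
move: cP; rewrite ler_norml; set t := _ - c => /andP[t1 t2]. nra.
Qed.

(** The size reduced representative of such a u has length at most |b| / 2, too
short to be nonzero; so b generates the kernel of the projection. *)
Lemma perp_part_eq0 u : L u -> perp_part b u = 0 ->
  exists2 c, c \is a Num.int & u = c *: b.
Proof.
move=> Lu pu0; have [c [cZ Lv _ +]] := size_reduction Lu.
rewrite pu0 dot0l mulr0 add0r => v_short; exists c => //.
apply/eqP; rewrite -subr_eq0; apply: contraT => nz_v.
have := b_short Lv nz_v; have := bb_gt0; lra.
Qed.

(** For a size reduced v with nonzero projection w, near-minimality of b bounds
|b| by 2 |w|, so that the component along b adds at most |w|^2 to |v|^2. *)
Lemma short_lift u : L u -> exists v, [/\ L v, perp_part b v = perp_part b u &
  dot v v <= 2 * dot (perp_part b u) (perp_part b u)].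
Proof.
move=> Lu; have [c [cZ Lv pv v_short]] := size_reduction Lu.
have [pu0|nz_pu] := eqVneq (perp_part b u) 0.
  exists 0; rewrite dot0l pu0 dot0l mulr0; split=> //.
    exact: subgroup0 dL.
  by rewrite perp_part0.
exists (u - c *: b); split=> //.
have nz_v : u - c *: b != 0.
  by apply: contra nz_pu => /eqP v0; apply/eqP; rewrite -pv v0 perp_part0.
have := b_short Lv nz_v; lra.
Qed.

Lemma discrete_projection : discrete_subgroup (perp_part b @` L).
Proof.
split.
- by exists 0; [exact: subgroup0 dL | exact: perp_part0].
- move=> _ _ [u Lu <-] [v Lv <-]; exists (u - v); last exact: perp_partB.
  exact: subgroupB.
exists (dot b b / 4); first by rewrite divr_gt0.
move=> _ [u Lu <-] nz_pu; have [v [Lv pv v_short]] := short_lift Lu.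
have nz_v : v != 0.
  by apply: contra nz_pu => /eqP v0; apply/eqP; rewrite -pv v0 perp_part0.
have := b_short Lv nz_v; lra.
Qed.

(** Otherwise some multiple j b has length at most r while j |d| lies in
]1/4, 1/2], contradicting that h (j b), which is j d modulo Z, is within 1/4 of
an integer. *)
Lemma small_remainder h (r : R) (d : R) : additive_modZ L h -> 0 < r ->
  (forall u, L u -> dot u u <= r ^+ 2 ->
     exists2 c, c \is a Num.int & `|h u - c| <= 4^-1) ->
  h b - d \is a Num.int -> `|d| <= 2^-1 ->
  4 * d ^+ 2 * r ^+ 2 <= dot b b.
Proof.
move=> hL r0 hr hd d2; rewrite leNgt; apply/negP => b_lt.
have nz_d : 0 < `|d|.
  rewrite normr_gt0; apply: contraTneq b_lt => ->.
  by rewrite expr0n /= mulr0 mul0r -leNgt ltW.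
have [j /andP[j1 j2]] := multiple_in_quarter_half nz_d d2.
have jd : j%:R * `|d| = `|j%:R * d| by rewrite normrM normr_nat.
have [||c cZ hc] := hr (j%:R *: b).
- exact: subgroupMn.
- rewrite dotZl dotZr.
  have : (j%:R * `|d|) ^+ 2 <= 4^-1.
    have : 0 <= j%:R * `|d| by rewrite mulr_ge0.
    by move: j2; set t := _ * _ => ? ?; nra.
  rewrite exprMn real_normK ?num_real // => jd4.
  rewrite mulrA -expr2.
  apply: le_trans (_ : j%:R ^+ 2 * (4 * d ^+ 2 * r ^+ 2) <= _).
    by rewrite ler_wpM2l ?sqr_ge0 // ltW.
  have -> : j%:R ^+ 2 * (4 * d ^+ 2 * r ^+ 2) =
            (4 * (j%:R ^+ 2 * d ^+ 2)) * r ^+ 2 by ring.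
  by rewrite ler_piMl ?sqr_ge0 //; lra.
have jdc : `|j%:R * d| <= 4^-1.
  apply: (@near_int0 _ _ (c - (h (j%:R *: b) - j%:R * h b)
                            - j%:R * (h b - d))).
  - by rewrite -jd.
  - rewrite rpredB //; last by rewrite rpredM // natr_int.
    by rewrite rpredB //; exact: (modZMn dL).
  - by move: hc; congr (is_true (`|_| <= _)); ring.
lra.
Qed.

(** The kernel of the projection is generated by b, where h is an integer; hence
h descends modulo Z to the projected lattice. *)
Lemma modZ_perp_part_eq h u v : additive_modZ L h -> h b \is a Num.int ->
  L u -> L v -> perp_part b u = perp_part b v -> h u - h v \is a Num.int.
Proof.
move=> hL hb Lu Lv uv.
have [||c cZ uvc] := @perp_part_eq0 (u - v).
- exact: subgroupB.
- by rewrite perp_partB uv subrr.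
have := hL _ _ Lu Lv; have := modZMz dL hL cZ Lb; rewrite -uvc => H1 H2.
have := rpredB (rpredD H1 (rpredM cZ hb)) H2.
by congr (is_true (_ \is a Num.int)); ring.
Qed.

Lemma additive_modZ_projection h (s : 'rV[R]_n -> 'rV[R]_n) :
  additive_modZ L h -> h b \is a Num.int ->
  (forall w, (perp_part b @` L) w -> L (s w) /\ perp_part b (s w) = w) ->
  additive_modZ (perp_part b @` L) (h \o s).
Proof.
move=> hL hb sP w1 w2 Lw1 Lw2 /=.
have Lw : (perp_part b @` L) (w1 - w2).
  by case: discrete_projection => _ + _; exact.
have [[[Ls1 s1] [Ls2 s2]] [Ls12 s12]] := (sP _ Lw1, sP _ Lw2, sP _ Lw).
have s12E : perp_part b (s (w1 - w2)) = perp_part b (s w1 - s w2).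
  by rewrite perp_partB s1 s2 s12.
have := rpredD (modZ_perp_part_eq hL hb Ls12 (subgroupB dL Ls1 Ls2) s12E)
               (hL _ _ Ls1 Ls2).
by rewrite subrKA.
Qed.

End Projection.

(** * From approximate to exact integrality *)

(** The number of terms is fixed in advance: only then do combinations taken at
each index assemble into one finite combination over the hyperreals. *)
Definition combination L (m : nat) z :=
  exists (c : 'I_m -> R) (u : 'I_m -> 'rV[R]_n),
    (forall j, L (u j)) /\ z = \sum_(j < m) c j *: u j.

Lemma combination0 L m : L 0 -> combination L m 0.
Proof.
by move=> L0; exists (fun=> 0), (fun=> 0); split=> //; rewrite big1 // => j _;
   rewrite scaler0.
Qed.

(** Each projected vector differs from a lattice vector by a multiple of b, so
all the error terms are absorbed into the coefficient of b. *)
Lemma combination_projection L b m z a : L b ->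
  combination (perp_part b @` L) m z -> combination L m.+1 (a *: b + z).
Proof.
move=> Lb [c [w [Lw ->]]].
have /boolp.choice[u uP] j : exists u, L u /\ perp_part b u = w j.
  by have [u Lu <-] := Lw j; exists u.
pose t := \sum_(j < m) c j * (dot (u j) b / dot b b).
exists (fun j => if unlift ord0 j is Some k then c k else a - t),
       (fun j => if unlift ord0 j is Some k then u k else b); split.
  by move=> j; case: unliftP => // k _; case: (uP k).
rewrite big_ord_recl unlift_none scalerBl -addrA; congr (_ + _).
rewrite scaler_suml addrC -sumrB; apply: eq_bigr => j _.
by rewrite liftK -(proj2 (uP j)) scalerBr scalerA.
Qed.

Lemma combination_orthogonal L b m z : (forall w, L w -> dot w b = 0) ->
  combination L m z -> dot z b = 0.
Proof.
move=> Lb [c [u [Lu ->]]]; rewrite dotC dot_sumr big1 // => j _.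
by rewrite dotZr dotC Lb ?mulr0.
Qed.

Lemma additive_modZ_dot L h z : additive_modZ L h ->
  additive_modZ L (fun u => h u + dot u z).
Proof.
move=> hL u v Lu Lv; have := hL u v Lu Lv; rewrite dotBl.
by congr (is_true (_ \is a Num.int)); ring.
Qed.

(** The constants d and r depend on m and e but neither on the lattice nor on h;
this uniformity is what makes the result transferable.  The rank is measured by
a matrix A whose row space contains L. *)
Lemma exact_from_approximate (m : nat) : forall e : R, 0 < e ->
  exists d r : R, [/\ 0 < d, 0 < r &
  forall L (A : 'M[R]_n) h, discrete_subgroup L ->
    (forall u, L u -> (u <= A)%MS) -> (\rank A <= m)%N ->
    additive_modZ L h ->
    (forall u, L u -> dot u u <= r ^+ 2 ->
       exists2 c, c \is a Num.int & `|h u - c| <= d) ->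
  exists z, [/\ combination L m z, dot z z <= e ^+ 2
    & forall v, L v -> h v + dot v z \is a Num.int]].
Proof.
have trivial L h e : discrete_subgroup L -> additive_modZ L h ->
    (forall u, L u -> u = 0) -> forall m,
    exists z, [/\ combination L m z, dot z z <= e ^+ 2
      & forall v, L v -> h v + dot v z \is a Num.int].
  move=> dL hL L_eq0 k; exists 0; split.
  - exact/combination0/(subgroup0 dL).
  - by rewrite dot0l sqr_ge0.
  by move=> v /L_eq0 ->; rewrite dot0l addr0; exact: (modZ0 dL).
elim: m => [|m IHm] e e0.
  exists 1, 1; split=> // L A h dL LA rA hL _; apply: trivial => // u /LA.
  by move: rA; rewrite leqn0 mxrank_eq0 => /eqP ->; rewrite submx0 => /eqP.
have e2 : 0 < e / 2 by rewrite divr_gt0.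
have [d2 [r2 [d2_gt0 r2_gt0 IH]]] := IHm _ e2.
(* The three summands make lifts of vectors of length at most r2 no longer than
   r, the correction along b at most e / 2, and its effect on those lifts at
   most d2 / 2, respectively. *)
pose r := 2 * r2 + e^-1 + 2 * r2 / d2.
have [p1 p2 p3] : [/\ 0 < 2 * r2, 0 < e^-1 & 0 < 2 * r2 / d2].
  by rewrite divr_gt0 ?mulr_gt0 ?invr_gt0.
have r_gt0 : 0 < r by rewrite !addr_gt0.
have r_r2 : 2 * r2 <= r by rewrite /r; lra.
have re : 1 <= r * e by rewrite -ler_pdivrMr // div1r /r; lra.
have rd2 : 2 * r2 <= r * d2 by rewrite -ler_pdivrMr // /r; lra.
exists (Num.min 4^-1 (d2 / 2)), r; split=> //.
  by rewrite lt_min invr_gt0 ltr0n divr_gt0.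
move=> L A h dL LA rA hL h_near.
have [ex_nz|no_nz] := pselect (exists2 u, L u & u != 0); last first.
  apply: trivial => // u Lu; apply/eqP; apply: contraT => u0.
  by case: no_nz; exists u.
(* The vector z1 below corrects h along b, after which h1 is integral at b. *)
have [b [Lb nz_b b_short]] := exists_near_shortest dL ex_nz.
have bb_gt0 := dot_gt0 nz_b.
have [c0 c0Z c0P] := nearest_int (h b).
pose d := h b - c0.
have d_small : 4 * d ^+ 2 * r ^+ 2 <= dot b b.
  apply: (small_remainder dL Lb nz_b hL r_gt0) => //; last first.
    by rewrite /d subKr.
  move=> u Lu /(h_near u Lu)[c cZ]; rewrite le_min => /andP[hc _].
  by exists c.
pose z1 := - (d / dot b b) *: b.
pose h1 u := h u + dot u z1.
have h1L : additive_modZ L h1 by exact: additive_modZ_dot.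
have h1b : h1 b \is a Num.int.
  by rewrite /h1 dotZr mulNr divfK ?gt_eqF // /d subKr.
pose L2 := perp_part b @` L.
have dL2 : discrete_subgroup L2 := discrete_projection dL Lb nz_b b_short.
have /boolp.choice[s sP] w : exists u, L2 w ->
    [/\ L u, perp_part b u = w & dot u u <= 2 * dot w w].
  have [[u Lu <-]|nL2w] := pselect (L2 w).
    by have [v vP] := short_lift dL Lb nz_b b_short Lu; exists v.
  by exists 0.
have sP' w : L2 w -> L (s w) /\ perp_part b (s w) = w by case/sP.
(* The lifts s w are arbitrary choices, so h1 \o s is additive only modulo Z. *)
have [] := IH L2 (A :&: kermx b^T)%MS (h1 \o s) dL2.
- move=> _ [u Lu <-]; rewrite sub_capmx; apply/andP; split.
    by rewrite /perp_part -scaleNr addmx_sub ?scalemx_sub ?LA.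
  apply/sub_kermxP/matrixP => i j; rewrite !ord1 [RHS]mxE.
  rewrite -(dot_perp_part u nz_b) mxE.
  by apply: eq_bigr => k _; rewrite [_^T _ _]mxE.
(* b itself lies in A but not in its own orthogonal complement, so the rank
   drops. *)
- rewrite -ltnS; apply: leq_trans rA; apply: rank_ltmx.
  rewrite ltmxE capmxSl /=; apply/negP => AA.
  have := submx_trans (LA b Lb) AA.
  rewrite sub_capmx => /andP[_ /sub_kermxP/matrixP/(_ 0 0)].
  rewrite !mxE => bb0; suff : dot b b = 0 by move/eqP; rewrite gt_eqF.
  by rewrite -bb0; apply: eq_bigr => k _; rewrite [_^T _ _]mxE.
- exact: (additive_modZ_projection dL Lb nz_b b_short h1L h1b sP').
- move=> w L2w w_le; have [Lsw psw sw_le] := sP w L2w.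
  have [|c cZ] := h_near _ Lsw.
    apply: (le_trans sw_le); apply: le_trans (_ : (2 * r2) ^+ 2 <= _).
      by move: w_le; rewrite exprMn; have := sqr_ge0 r2; lra.
    by rewrite ler_pXn2r // nnegrE ?mulr_ge0 // ltW.
  rewrite le_min => /andP[_ hc]; exists c => //=.
  rewrite /h1 /= dotZr.
  set t := dot (s w) b / dot b b.
  have tb : t ^+ 2 * dot b b <= dot (s w) (s w).
    by rewrite (pythagoras (s w) nz_b) lerDr dot_ge0.
  have -> : - (d / dot b b) * dot (s w) b = - (d * t) by rewrite /t; ring.
  have dt : `|d * t| <= d2 / 2.
    have d2_2 : 0 <= d2 / 2 by rewrite divr_ge0 // ltW.
    rewrite -(ler_pXn2r (n := 2)) ?nnegrE // real_normK ?num_real //.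
    have -> : (d * t) ^+ 2 = d ^+ 2 * t ^+ 2 by exact: exprMn.
    have -> : (d2 / 2) ^+ 2 = d2 ^+ 2 / 4 by field.
    have r4 : 0 < 4 * r ^+ 2 by rewrite mulr_gt0 ?exprn_gt0.
    rewrite -(ler_pM2l r4).
    have td : t ^+ 2 * (4 * d ^+ 2 * r ^+ 2) <= t ^+ 2 * dot b b.
      by rewrite ler_wpM2l ?sqr_ge0.
    have rd2' : (2 * r2) ^+ 2 <= (r * d2) ^+ 2.
      by rewrite ler_pXn2r // nnegrE mulr_ge0 // ltW.
    rewrite !exprMn in rd2'.
    have := sqr_ge0 r2; move: rd2' td tb sw_le w_le.
    set D := d2 ^+ 2; set r22 := r2 ^+ 2; set T := t ^+ 2; set E := d ^+ 2.
    set rr := r ^+ 2. lra.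
  move: dt hc; set y := d * t; set x := h _.
  by rewrite !ler_norml => /andP[? ?] /andP[? ?]; apply/andP; split; lra.
move=> z2 [z2_comb z2_le z2_int].
have z2b : dot z2 b = 0.
  apply: combination_orthogonal z2_comb => _ [u Lu <-].
  exact: dot_perp_part.
exists (z1 + z2); split.
- exact: combination_projection.
- have -> : dot (z1 + z2) (z1 + z2) = d ^+ 2 / dot b b + dot z2 z2.
    rewrite dotDl !dotDr dotZr (dotC z1 b) !dotZr !dotZl z2b (dotC b) z2b.
    by field; rewrite gt_eqF.
  have dB : d ^+ 2 / dot b b <= e ^+ 2 / 4.
    rewrite ler_pdivrMr //.
    have re2 : 1 <= r ^+ 2 * e ^+ 2 by rewrite -exprMn exprn_ege1.
    have := ler_wpM2l (sqr_ge0 e) d_small.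
    have := ler_wpM2l (sqr_ge0 d) re2.
    lra.
  by move: z2_le; rewrite exprMn exprVn; have := sqr_ge0 e; lra.
move=> v Lv.
have Lpv : L2 (perp_part b v) by exists v.
have [Lsv psv] := sP' _ Lpv.
have := rpredD (modZ_perp_part_eq dL Lb nz_b b_short h1L h1b Lv Lsv (esym psv))
               (z2_int _ Lpv).
rewrite /= dot_perp_partl // /h1 dotDr.
by congr (is_true (_ \is a Num.int)); ring.
Qed.

End Rounding.

(** * Countable saturation *)

(** An ultrafilter containing a singleton is principal, so the finitely many
indices below k can be discarded one at a time. *)
Lemma nonprincipal_tail (D : set_system posnat) (UD : UltraFilter D) :
  nonprincipal D -> forall k : nat, D [set i | (k <= val i)%N].
Proof.
move=> npD; elim=> [|k IHk]; first by apply: filterS filterT.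
have [Dk|Dk] := in_ultra_setVsetC [set i | val i = k] UD; last first.
  by apply: filterS2 IHk Dk => i /= ki /eqP; rewrite eq_sym ltn_neqAle ki andbT.
have [i ik] := filter_ex Dk; case: (npD i); apply/seteqP.
have Di : D [set i].
  by apply: filterS Dk => j jk; apply/val_inj; rewrite [LHS]jk [RHS]ik.
split=> A.
  move=> DA; apply/principal_filterP.
  by have [_ [/[swap] ->]] := filter_ex (filterI DA Di).
by move=> /principal_filterP Ai; apply: filterS Di => _ ->.
Qed.

(** At index i, choose a point of B k i for the largest k not exceeding i for
which this set is nonempty. *)
Lemma countable_saturation (D : set_system posnat) (UD : UltraFilter D)
    (T : pointedType) (B : nat -> posnat -> set T) : nonprincipal D ->
  (forall k i, B k.+1 i `<=` B k i) ->
  (forall k, D [set i | B k i !=set0]) ->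
  exists z : posnat -> T, forall k, D [set i | B k i (z i)].
Proof.
move=> npD B_decr DB.
have B_le i k m : (k <= m)%N -> B m i `<=` B k i.
  move=> /subnKC <-; elim: (m - k)%N => [|l IHl]; first by rewrite addn0.
  by rewrite addnS => z /B_decr /IHl.
have /boolp.choice[z zP] i : exists z, forall k, (k <= val i)%N ->
    B k i !=set0 -> B k i z.
  elim: (val i) => [|m [z zP]].
    have [[z Bz]|nB] := pselect (B 0 i !=set0).
      by exists z => k; rewrite leqn0 => /eqP ->.
    by exists point => k; rewrite leqn0 => /eqP ->.
  have [[z' Bz']|nB] := pselect (B m.+1 i !=set0).
    by exists z' => k km _; exact: B_le Bz'.
  by exists z => k; rewrite leq_eqVlt => /predU1P[-> //|]; exact: zP.
exists z => k.
by apply: filterS2 (nonprincipal_tail UD npD k) (DB k) => i /=; exact: zP.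
Qed.

(** * Transfer to the hyperreals *)

Section LinearSpan.
Variables (K : fieldType) (n : nat) (A : set 'rV[K]_n).

Lemma linear_span_add u v :
  linear_span A u -> linear_span A v -> linear_span A (u + v).
Proof.
move=> Au Av V VP; have [[_ /(_ 1 u v) VD] _] := VP.
rewrite -[u]scale1r; apply/set_mem/VD; apply/mem_set; [exact: Au|exact: Av].
Qed.

Lemma linear_span_sum (m : nat) (c : 'I_m -> K) (u : 'I_m -> 'rV[K]_n) :
  (forall j, A (u j)) -> linear_span A (\sum_(j < m) c j *: u j).
Proof.
move=> Au V [[V0 VD] AV]; apply: set_mem.
elim/big_rec: _ => // j y _ Vy; apply: VD => //; exact/mem_set/AV.
Qed.

End LinearSpan.

Section Transfer.
Variables (R : realType) (D : set_system posnat) (UD : UltraFilter D).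
Variable n : nat.

Lemma linear_span_ultraproduct (m : nat) (Li : posnat -> set 'rV[R]_n)
    (z : posnat -> 'rV[R]_n) : (forall i, Li i 0) ->
  D [set i | combination (Li i) m (z i)] ->
  linear_span (ultraproduct (UD := UD) Li) (hypvec UD z).
Proof.
move=> Li0 Dz.
have /boolp.choice[cu cuP] i : exists cu : ('I_m -> R) * ('I_m -> 'rV[R]_n),
    (forall j, Li i (cu.2 j)) /\
    (combination (Li i) m (z i) -> z i = \sum_(j < m) cu.1 j *: cu.2 j).
  have [[c [u [Lu zE]]]|nz] := pselect (combination (Li i) m (z i)).
    by exists (c, u).
  by exists (fun=> 0, fun=> 0).
have -> : hypvec UD z = \sum_(j < m) hyp UD (fun i => (cu i).1 j) *:
                                     hypvec UD (fun i => (cu i).2 j).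
  apply/rowP => k; rewrite mxE summxE.
  under eq_bigr do rewrite !mxE hypM.
  rewrite hyp_sum; apply/hypE; apply: filterS Dz => i /= /(proj2 (cuP i)) ->.
  by rewrite summxE; apply: eq_bigr => j _; rewrite mxE.
apply: linear_span_sum => j; exists (fun i => (cu i).2 j) => // i.
by case: (cuP i).
Qed.

Lemma finite_hypvec (u : posnat -> 'rV[R]_n) (r : R) : 0 < r ->
  (forall i, dot (u i) (u i) <= r ^+ 2) -> finite_vec (hypvec UD u).
Proof.
move=> r0 ur; exists (r + 1); first by rewrite addr_gt0.
rewrite enorm_hypvec hyp_abs; apply/ltr_hyp; apply: filterS filterT => i _ /=.
rewrite ger0_norm ?sqrtr_ge0 //; apply: le_lt_trans (_ : r < _).
  by rewrite -(ger0_norm (ltW r0)) -sqrtr_sqr ler_sqrt ?sqr_ge0.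
by rewrite ltrDl.
Qed.

Lemma infinitesimal_hypvec (z : posnat -> 'rV[R]_n) :
  (forall k : nat, D [set i | dot (z i) (z i) <= (k.+1%:R^-1) ^+ 2]) ->
  infinitesimal (enorm (hypvec UD z)).
Proof.
move=> zP r r0; rewrite enorm_hypvec hyp_abs; apply/ltr_hyp.
have [k kr] : exists k : nat, k.+1%:R^-1 < r.
  exists (Num.truncn r^-1).
  rewrite invf_plt ?posrE // ?ltr0n //.
  by have /truncn_itv/andP[] : 0 <= r^-1 by rewrite invr_ge0 ltW.
apply: filterS (zP k) => i /= zi.
rewrite ger0_norm ?sqrtr_ge0 //; apply: le_lt_trans kr.
have k0 : 0 <= k.+1%:R^-1 :> R by rewrite invr_ge0.
by rewrite -(ger0_norm k0) -sqrtr_sqr ler_sqrt ?sqr_ge0.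
Qed.

Lemma hyperint_ae (f : posnat -> R) : D [set i | f i \is a Num.int] ->
  hyperint (hyp UD f).
Proof.
move=> fZ; exists (fun i => Num.floor (f i)); apply/hypE.
by apply: filterS fZ => i /=; rewrite intrEfloor => /eqP ->.
Qed.

Lemma near_hyperint (f : posnat -> R) (d : R) : 0 < d ->
  infinitesimal (dist_hyperint (hyp UD f)) ->
  D [set i | exists2 c, c \is a Num.int & `|f i - c| <= d].
Proof.
move=> d0 /(_ d d0); have [[_ [c ->] ->] _] := dist_hyperint_min (hyp UD f).
rewrite normr_id hypB hyp_abs => /ltr_hyp; apply: filterS => i /= /ltW fd.
by exists (c i)%:~R => //; exact: intr_int.
Qed.

(** If it fails, then at almost every i some u i in Li i of length at most r has
its inner product with x i further than d from all integers.  The class of u is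
a finite vector of the ultraproduct which contradicts the hypothesis on x. *)
Lemma internal_exact_from_approximate (Li : posnat -> set 'rV[R]_n)
    (x : posnat -> 'rV[R]_n) (e : R) : 0 < e ->
  (forall i, is_lattice (Li i)) ->
  (forall u, ultraproduct (UD := UD) Li u -> finite_vec u ->
     infinitesimal (dist_hyperint (dot u (hypvec UD x)))) ->
  D [set i | exists z, [/\ combination (Li i) n z, dot z z <= e ^+ 2
     & forall v, Li i v -> dot v (x i) + dot v z \is a Num.int]].
Proof.
move=> e0 Li_lattice x_dual.
have dLi i := lattice_discrete_subgroup (Li_lattice i).
have [d [r [d0 r0 dr]]] := @exact_from_approximate R n n e e0.
set A := [set i | _]; have [//|DnA] := in_ultra_setVsetC A UD.
have /boolp.choice[u uP] i : exists u, [/\ Li i u, dot u u <= r ^+ 2 &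
    ~ A i -> ~ exists2 c, c \is a Num.int & `|dot u (x i) - c| <= d].
  have [Ai|nAi] := pselect (A i).
    exists 0; split=> //; first exact: subgroup0 (dLi i).
    by rewrite dot0l sqr_ge0.
  apply: contrapT => no_u; apply: nAi.
  apply: (dr (Li i) 1%:M (fun u => dot u (x i)) (dLi i)).
  - by move=> u _; exact: submx1.
  - exact: rank_leq_row.
  - by move=> u v _ _; rewrite dotBl subrr.
  - by move=> u Lu ur; apply: contrapT => nc; apply: no_u; exists u.
have Lu : ultraproduct (UD := UD) Li (hypvec UD u).
  by exists u => // i; case: (uP i).
have u_fin : finite_vec (hypvec UD u).
  by apply: (finite_hypvec r0) => i; case: (uP i).
have := x_dual _ Lu u_fin; rewrite dot_hypvec => /(near_hyperint d0) Dc.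
have [i [/= c nAi]] := filter_ex (filterI Dc DnA).
by have [_ _ /(_ nAi)] := uP i.
Qed.

End Transfer.

Theorem theorem4p5 (R : realType) (D : set_system posnat) (UD : UltraFilter D)
    (D_nonprincipal : nonprincipal D) (n : nat) (n_gt0 : (0 < n)%N)
    (L : set 'rV[hyperreal R UD]_n) (L_lattice : internal_lattice L)
    (x : 'rV[hyperreal R UD]_n) (x_finite : finite_vec x)
    (x_span : linear_span L x)
    (x_dual : forall u : 'rV[hyperreal R UD]_n,
       L u -> finite_vec u -> infinitesimal (dist_hyperint (dot u x))) :
  exists2 y : 'rV[hyperreal R UD]_n, dual_lattice L y & approx y x.
Proof.
have [Li Li_lattice LE] := L_lattice; have [xi xE] := hypvecP x.
rewrite {}LE {}xE in x_span x_dual *.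
pose B k i := [set z : 'rV[R]_n | [/\ combination (Li i) n z,
  dot z z <= (k.+1%:R^-1) ^+ 2
  & forall v, Li i v -> dot v (xi i) + dot v z \is a Num.int]].
have [||z zP] := @countable_saturation D UD 'rV[R]_n B D_nonprincipal.
- move=> k i z [z_comb z_le z_int]; split=> //; apply: le_trans z_le _.
  by rewrite ler_pXn2r ?nnegrE ?invr_ge0 // lef_pV2 ?posrE ?ltr0n // ler_nat.
- by move=> k; apply: internal_exact_from_approximate; rewrite ?invr_gt0 ?ltr0n.
have xzE : hypvec UD xi + hypvec UD z = hypvec UD (fun i => xi i + z i).
  by apply/rowP => j; rewrite !mxE hypD; apply: hyp_ext => i; rewrite mxE.
exists (hypvec UD xi + hypvec UD z); last first.
  rewrite /approx addrAC subrr add0r; apply: infinitesimal_hypvec => k.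
  by apply: filterS (zP k) => i [].
split.
  apply: linear_span_add => //; apply: (@linear_span_ultraproduct _ _ _ _ n).
    by move=> i; exact: subgroup0 (lattice_discrete_subgroup (Li_lattice i)).
  by apply: filterS (zP 0%N) => i [].
move=> _ [u Lu <-]; rewrite xzE dot_hypvec; apply: hyperint_ae.
by apply: filterS (zP 0%N) => i [_ _ z_int] /=; rewrite dotDr; exact: z_int.
Qed.
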